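(* Let $\alpha,\beta,\gamma\in\{0,1,2,\dots\}$, let $\mathfrak p\in K[\alpha]\backslash G/K[\beta]$ and $\mathfrak q\in K[\beta]\backslash G/K[\gamma]$, and let $\mathfrak P\in\mathcal L[\alpha,\beta]$, $\mathfrak Q\in\mathcal L[\beta,\gamma]$ be the corresponding surfaces. Then the surface in $\mathcal L[\alpha,\gamma]$ corresponding to the product of double cosets $\mathfrak p\circ\mathfrak q$ is the surface $\mathfrak R$ obtained by gluing $\mathfrak P$ and $\mathfrak Q$.
   Context: Groups. $S_\infty$ is the group of finitely supported permutations of $\mathbb N$, $G=S_\infty\times S_\infty\times S_\infty$ with elements $\mathbf g=(g_{red},g_{yellow},g_{blue})$, $K$ is the diagonal subgroup, $K[\alpha]\subset K$ is the subgroup of $(h,h,h)$ with $h$ fixing $1,\dots,\alpha$. Permutations act from the left. Let $\theta_j[\beta]\in K[\beta]$ be the diagonal element given by the permutation which exchanges $\beta+i$ and $\beta+j+i$ for $1\le i\le j$ and fixes all other points. Product of double cosets. For $\mathfrak p\in K[\alpha]\backslash G/K[\beta]$, $\mathfrak q\in K[\beta]\backslash G/K[\gamma]$ choose $p\in\mathfrak p$, $q\in\mathfrak q$. The sequence $K[\alpha]\,p\,\theta_j[\beta]\,q\,K[\gamma]$ is eventually constant in $j$, and its limit, independent of the choices of $p,q$, is by definition $\mathfrak p\circ\mathfrak q$. Surfaces. A triangulated surface is glued from triangles along sides, each edge being incident to exactly two triangles; a double triangle is a sphere glued from two triangles along their perimeters. $\mathcal L[\alpha,\beta]$ is the set (up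 to combinatorial equivalence) of compact oriented triangulated, not necessarily connected, surfaces with: signs plus/minus on triangles, arranged checkerwise; edges colored red, yellow, blue, the colors of the sides of each plus-triangle being arranged clockwise and those of each minus-triangle anticlockwise; an injective map $\iota^+$ from $\{1,\dots,\beta\}$ to the set of plus-triangles and an injective map $\iota^-$ from $\{1,\dots,\alpha\}$ to the set of minus-triangles (the labels); each double-triangle component has at least one label. Correspondence. For $\mathbf g\in G$ take plus-triangles and minus-triangles, each family numbered by $\mathbb N$, with sides colored red, yellow, blue clockwise, resp. anticlockwise; for each color $\nu$ and each $k$, if $g_\nu k=l$, glue the $\nu$-side of the $k$-th plus-triangle to the $\nu$-side of the $l$-th minus-triangle compatibly with orientations. Then forget the numbers $>\beta$ on plus-triangles and $>\alpha$ on minus-triangles and discard double triangles having no label. The result is the element of $\mathcal L[\alpha,\beta]$ corresponding to $K[\alpha]\mathbf gK[\beta]$. Gluing. For $\mathfrak P\in\mathcal L[\alpha,\beta]$, $\mathfrak Q\in\mathcal L[\beta,\gamma]$: for each $k\in\{1,\dots,\beta\}$ remove the interiors of the plus-triangle $\iota^+_{\mathfrak P}(k)$ of $\mathfrak P$ and of the minus-triangle $\iota^-_{\mathfrak Q}(k)$ of $\mathfrak Q$, and glue the boundaries of the two resulting holes according to the colors of edges. The result consists of triangles glued along edges, each edge incident to exactly two triangles, but some vertices may be pasted together; cut all such pastings of vertices (so that the result is a surface, i.e. triangles are glued only via their edges). Keep signs, colors and the remaining labels ($\iota^-$ of $\mathfrak P$ and $\iota^+$ of $\mathfrak Q$), and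 discard double triangles without labels. The result is $\mathfrak R\in\mathcal L[\alpha,\gamma]$. *)

(* Defs.v *)
From HB Require Import structures.
From mathcomp Require Import all_boot zify.
From mathcomp Require Import boolp classical_sets functions cardinality.

Set Implicit Arguments.
Unset Strict Implicit.
Unset Printing Implicit Defensive.

Local Open Scope classical_set_scope.
Local Open Scope group_scope.

(* Throughout, the index set {1, 2, ...} is shifted to {0, 1, ...} = nat, so
   that the labels 1, ..., alpha become the numbers k < alpha. *)

Record Sinf := MkSinf {
  sfun :> nat -> nat;
  sfun_bij : bijective sfun;
  sfun_fin : finite_set [set n | sfun n <> n]
}.

Lemma sinfP (f g : Sinf) : f =1 g -> f = g.
Proof.
case: f g => [f fb ff] [g gb gf] /= /funext fg; case: g / fg gb gf => gb gf.
by congr MkSinf; apply: Prop_irrelevance.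
Qed.

Lemma nat_finite_setP (A : set nat) :
  finite_set A <-> exists N, forall n, A n -> n < N.
Proof.
split=> [/finite_seqP[s ->]|[N AN]].
  exists (\max_(i <- s) i).+1 => n /= ns.
  by rewrite ltnS; apply: (@leq_bigmax_seq _ s predT id n).
apply: (@sub_finite_set _ _ `I_N) => [n /AN //|]; exact: finite_II.
Qed.

Lemma sinf_bound (f : Sinf) : exists N, forall n, N <= n -> f n = n.
Proof.
have /nat_finite_setP[N fN] := sfun_fin f; exists N => n Nn.
by apply: contrapT => /fN; rewrite ltnNge Nn.
Qed.

Definition sinf_bounded (f : nat -> nat) (fb : bijective f)
    (fN : exists N, forall n, N <= n -> f n = n) : Sinf.
Proof.
apply: (MkSinf fb); apply/nat_finite_setP; case: fN => N fN; exists N => n nf.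
by rewrite ltnNge; apply/negP => /fN.
Defined.

HB.instance Definition _ := gen_eqMixin Sinf.
HB.instance Definition _ := gen_choiceMixin Sinf.

Definition sinf_one : Sinf.
Proof. by apply: (@sinf_bounded id); [exists id|exists 0]. Defined.

Definition sinf_mul (f g : Sinf) : Sinf.
Proof.
apply: (@sinf_bounded (f \o g)); first exact: bij_comp (sfun_bij f) (sfun_bij g).
have [[N fN] [M gM]] := (sinf_bound f, sinf_bound g).
exists (maxn N M) => n; rewrite geq_max => /andP[Nn Mn].
by rewrite /= gM // fN.
Defined.

Lemma sinf_surj (f : Sinf) n : exists m, f m == n.
Proof. by have [g _ fK] := sfun_bij f; exists (g n); rewrite fK. Qed.

Definition sinf_inv_fun (f : Sinf) n := xchoose (sinf_surj f n).

Lemma sinf_inv_funK (f : Sinf) : cancel (sinf_inv_fun f) f.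
Proof. by move=> n; apply/eqP/(xchooseP (sinf_surj f n)). Qed.

Lemma sinf_funK (f : Sinf) : cancel f (sinf_inv_fun f).
Proof. by move=> n; apply: (bij_inj (sfun_bij f)); rewrite sinf_inv_funK. Qed.

Definition sinf_inv (f : Sinf) : Sinf.
Proof.
apply: (@sinf_bounded (sinf_inv_fun f)).
  by exists f; [exact: sinf_inv_funK|exact: sinf_funK].
have [N fN] := sinf_bound f; exists N => n Nn.
by rewrite -[in LHS](fN _ Nn) sinf_funK.
Defined.

Lemma sinf_mulA : associative sinf_mul. Proof. by move=> f g h; apply: sinfP. Qed.
Lemma sinf_mul1 : left_id sinf_one sinf_mul. Proof. by move=> f; apply: sinfP. Qed.
Lemma sinf_mul1r : right_id sinf_one sinf_mul. Proof. by move=> f; apply: sinfP. Qed.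
Lemma sinf_mulV : left_inverse sinf_one sinf_inv sinf_mul.
Proof. by move=> f; apply: sinfP => n /=; rewrite sinf_funK. Qed.
Lemma sinf_mulVr : right_inverse sinf_one sinf_inv sinf_mul.
Proof. by move=> f; apply: sinfP => n /=; rewrite sinf_inv_funK. Qed.

(* Permutations act from the left: (f * g) n = f (g n). *)
HB.instance Definition _ :=
  isGroup.Build Sinf sinf_mulA sinf_mul1 sinf_mul1r sinf_mulV sinf_mulVr.

Lemma sinfM (f g : Sinf) n : (f * g) n = f (g n). Proof. by []. Qed.
Lemma sinf1 n : (1 : Sinf) n = n. Proof. by []. Qed.
Lemma sinfK (f : Sinf) : cancel f (f^-1)%g. Proof. exact: sinf_funK. Qed.
Lemma sinfVK (f : Sinf) : cancel (f^-1)%g f. Proof. exact: sinf_inv_funK. Qed.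
Lemma sinf_inj (f : Sinf) : injective f. Proof. exact: can_inj (sinfK f). Qed.

Variant color := Red | Yellow | Blue.

Definition eq_color (c d : color) : bool :=
  match c, d with
  | Red, Red | Yellow, Yellow | Blue, Blue => true
  | _, _ => false
  end.

Lemma eq_colorP : Equality.axiom eq_color.
Proof. by case=> [] []; constructor. Qed.

HB.instance Definition _ := hasDecEq.Build color eq_colorP.

Definition next_color (c : color) : color :=
  match c with Red => Yellow | Yellow => Blue | Blue => Red end.

(* (g_red, g_yellow, g_blue), with the componentwise multiplication. *)
Notation G := ((Sinf * Sinf) * Sinf)%type.

Definition component (g : G) (c : color) : Sinf :=
  match c with Red => g.1.1 | Yellow => g.1.2 | Blue => g.2 end.

Definition diagonal (h : Sinf) : G := ((h, h), h).

Definition Ksub (alpha : nat) : set G :=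
  [set diagonal h | h in [set h : Sinf | forall i, i < alpha -> h i = i]].

Lemma componentM (g h : G) c : component (g * h) c = component g c * component h c.
Proof. by case: c. Qed.

Lemma GP (g h : G) : (forall c, component g c =1 component h c) -> g = h.
Proof.
case: g h => [[a b] c] [[a' b'] c'] E.
by congr ((_, _), _); apply: sinfP; [exact: (E Red)|exact: (E Yellow)|exact: (E Blue)].
Qed.

(* theta_j[beta]: exchanges beta + i and beta + j + i for i < j. *)
Definition theta_fun (beta j n : nat) : nat :=
  if n < beta then n
  else if n < beta + j then (n + j)%N
  else if n < beta + j + j then (n - j)%N
  else n.

Lemma theta_funK beta j : involutive (theta_fun beta j).
Proof. by move=> n; rewrite /theta_fun; repeat case: ifP; lia. Qed.

Lemma theta_bound beta j : exists N, forall n, N <= n -> theta_fun beta j n = n.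
Proof.
by exists (beta + j + j)%N => n; rewrite /theta_fun; repeat case: ifP; lia.
Qed.

Definition theta (beta j : nat) : Sinf :=
  sinf_bounded (inv_bij (@theta_funK beta j)) (theta_bound beta j).

Definition double_coset (alpha beta : nat) (g : G) : set G :=
  [set x | exists k h, [/\ Ksub alpha k, Ksub beta h & x = k * g * h]].

Record dcoset (alpha beta : nat) := MkDcoset {
  dcoset_set :> set G;
  dcoset_ax : exists g, dcoset_set = double_coset alpha beta g
}.

Lemma Ksub_mul alpha h h' : Ksub alpha h -> Ksub alpha h' -> Ksub alpha (h * h').
Proof.
move=> [k kK <-] [k' k'K <-]; exists (k * k') => //= i ia.
by rewrite k'K // kK.
Qed.

Lemma Ksub_inv alpha h : Ksub alpha h -> Ksub alpha h^-1.
Proof.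
by move=> [k kK <-]; exists k^-1 => // i ia; rewrite -[in LHS](kK _ ia) sinfK.
Qed.

Lemma Ksub1 alpha : Ksub alpha 1.
Proof. by exists 1. Qed.

Lemma double_coset_refl alpha beta g : double_coset alpha beta g g.
Proof. by exists 1, 1; split; [exact: Ksub1|exact: Ksub1|rewrite mul1g mulg1]. Qed.

Lemma double_coset_eq alpha beta (g k h : G) : Ksub alpha k -> Ksub beta h ->
  double_coset alpha beta (k * g * h) = double_coset alpha beta g.
Proof.
move=> kK hK; apply/seteqP; split=> x [k' [h' [k'K h'K ->]]].
  exists (k' * k), (h * h'); split; [exact: Ksub_mul|exact: Ksub_mul|].
  by rewrite !mulgA.
exists (k' * k^-1), (h^-1 * h'); split.
- exact/Ksub_mul/Ksub_inv.
- exact/Ksub_mul/h'K/Ksub_inv.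
- by rewrite !mulgA mulgVK mulgK.
Qed.

Lemma G_bound (g : G) : exists N, forall c n, N <= n -> component g c n = n.
Proof.
have [[N NP] [M MP]] := (sinf_bound g.1.1, sinf_bound g.1.2).
have [L LP] := sinf_bound g.2.
exists (N + M + L)%N => -[] n /= nP; [apply: NP|apply: MP|apply: LP]; lia.
Qed.

Lemma disjoint_commute (N : nat) (u : Sinf) (g : G) :
    (forall n, n < N -> u n = n) ->
    (forall c n, N <= n -> component g c n = n) ->
  diagonal u * g = g * diagonal u.
Proof.
move=> uN gN; apply: GP => c n; rewrite !componentM.
have -> : component (diagonal u) c = u by case: c.
rewrite !sinfM; case: (ltnP n N) => nN.
  rewrite (uN n) // uN // ltnNge; apply/negP => gnN.
  by have /sinf_inj := gN c _ gnN; lia.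
rewrite (gN c n) // gN // leqNgt; apply/negP => unN.
by have /sinf_inj := uN _ unN; lia.
Qed.

Definition swap_fun (a b w n : nat) : nat :=
  if (a <= n) && (n < a + w) then (n - a + b)%N
  else if (b <= n) && (n < b + w) then (n - b + a)%N
  else n.

Lemma swap_funK a b w : a + w <= b -> involutive (swap_fun a b w).
Proof. by move=> abw n; rewrite /swap_fun; repeat case: ifP; lia. Qed.

Lemma thetaK beta j : theta beta j * theta beta j = 1.
Proof. by apply: sinfP => n; rewrite sinfM /= theta_funK. Qed.

Definition theta_product (beta : nat) (p q : G) (j : nat) : G :=
  p * diagonal (theta beta j) * q.

Lemma theta_product_far alpha beta gamma (p q : G) N i j :
    alpha <= N -> gamma <= N -> beta <= N ->
    (forall c n, N <= n -> component p c n = n) ->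
    (forall c n, N <= n -> component q c n = n) ->
    N <= i -> i + N <= j ->
  double_coset alpha gamma (theta_product beta p q j) =
  double_coset alpha gamma (theta_product beta p q i).
Proof.
move=> aN gN bN pN qN Ni ij.
have swK : involutive (swap_fun (beta + i) (beta + j) (N - beta)).
  by apply: swap_funK; lia.
have swb : exists M, forall n, M <= n ->
    swap_fun (beta + i) (beta + j) (N - beta) n = n.
  by exists (j + N)%N => n; rewrite /swap_fun; repeat case: ifP; lia.
pose u : Sinf := sinf_bounded (inv_bij swK) swb.
pose v : Sinf := theta beta i * u * theta beta j.
have uu : u * u = 1 by apply: sinfP => n; rewrite sinfM /= swK.
have uN n : n < N -> u n = n by rewrite /= /swap_fun; repeat case: ifP; lia.
have vN n : n < N -> v n = n.
  by rewrite !sinfM /= /theta_fun /swap_fun; repeat case: ifP; lia.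
have thE : theta beta j = u * theta beta i * v.
  rewrite /v !mulgA -(mulgA u) thetaK mulg1 uu mul1g //.
have dM (f g : Sinf) : diagonal (f * g) = diagonal f * diagonal g by [].
clearbody v; clear uu; clearbody u.
have -> : theta_product beta p q j =
    diagonal u * theta_product beta p q i * diagonal v.
  rewrite /theta_product thE !dM -!mulgA (disjoint_commute vN qN).
  by rewrite (mulgA p) -(disjoint_commute uN pN) -!mulgA.
rewrite double_coset_eq //.
  by exists u => // n na /=; apply: uN; lia.
by exists v => // n na /=; apply: vN; lia.
Qed.

Lemma theta_product_const alpha beta gamma (p q : G) : exists N, forall j, N <= j ->
  double_coset alpha gamma (theta_product beta p q j) =
  double_coset alpha gamma (theta_product beta p q N).
Proof.
have [[N NP] [M MP]] := (G_bound p, G_bound q).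
pose L := (N + M + alpha + beta + gamma)%N; exists L => j Lj.
rewrite -(@theta_product_far alpha beta gamma p q L j (j + L + L)) //;
  try solve [rewrite /L; lia | by move=> c n nL; apply: NP; lia
            | by move=> c n nL; apply: MP; lia].
rewrite -(@theta_product_far alpha beta gamma p q L L (j + L + L)) //;
  solve [rewrite /L; lia | by move=> c n nL; apply: NP; lia
            | by move=> c n nL; apply: MP; lia].
Qed.

Lemma theta_conj beta (h : G) M : Ksub beta h ->
  exists N, forall j, N <= j -> exists u : Sinf,
    [/\ forall n, n < M -> u n = n,
        h * diagonal (theta beta j) = diagonal (theta beta j) * diagonal u &
        diagonal (theta beta j) * h = diagonal u * diagonal (theta beta j)].
Proof.
move=> [k kK <-]; have [L LP] := sinf_bound k.
exists (L + M)%N => j jN; exists (theta beta j * k * theta beta j).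
have dM (f g : Sinf) : diagonal (f * g) = diagonal f * diagonal g by [].
split.
- move=> n nM; rewrite !sinfM.
  suff -> : k (theta beta j n) = theta beta j n by rewrite /= theta_funK.
  rewrite /= /theta_fun; case: ifP => nb; first exact: kK.
  by case: ifP => nbj; apply: LP; lia.
- by rewrite -!dM !mulgA thetaK mul1g.
- by rewrite -!dM -!mulgA thetaK mulg1.
Qed.

Lemma theta_product_indep alpha beta gamma (p q p' q' : G) :
    double_coset alpha beta p p' -> double_coset beta gamma q q' ->
  exists N, forall j, N <= j ->
    double_coset alpha gamma (theta_product beta p' q' j) =
    double_coset alpha gamma (theta_product beta p q j).
Proof.
move=> [k [h [kK hK ->]]] [h' [l [h'K lK ->]]].
have [[Np NpP] [Nq NqP]] := (G_bound p, G_bound (h' * q)).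
have [N1 N1P] := theta_conj (Nq + gamma) hK.
have [N2 N2P] := theta_conj (Np + alpha) h'K.
exists (N1 + N2)%N => j jN.
have [|u [uN uE _]] := N1P j; first by lia.
have [|v [vN _ vE]] := N2P j; first by lia.
have uq : diagonal u * (h' * q) = (h' * q) * diagonal u.
  by apply: disjoint_commute NqP => n nN; apply: uN; lia.
have vp : diagonal v * p = p * diagonal v.
  by apply: disjoint_commute NpP => n nN; apply: vN; lia.
have -> : theta_product beta (k * p * h) (h' * q * l) j =
    k * (diagonal v * theta_product beta p q j * diagonal u) * l.
  rewrite /theta_product -!mulgA; congr (k * _).
  rewrite (mulgA h) uE -!mulgA (mulgA h') (mulgA (diagonal u)) uq.
  rewrite -!mulgA (mulgA _ h') vE -!mulgA (mulgA p (diagonal v)) -vp.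
  by rewrite -!mulgA.
rewrite double_coset_eq // double_coset_eq //.
  by exists v => // n na; apply: vN; lia.
by exists u => // n na; apply: uN; lia.
Qed.

Definition is_product alpha beta gamma (p : dcoset alpha beta)
    (q : dcoset beta gamma) (r : dcoset alpha gamma) : Prop :=
  forall p0 q0, dcoset_set p p0 -> dcoset_set q q0 ->
  exists N, forall j, N <= j ->
    double_coset alpha gamma (p0 * diagonal (theta beta j) * q0) = r.

Lemma dcoset_mem alpha beta (p : dcoset alpha beta) : exists g, dcoset_set p g.
Proof. by have [g pE] := dcoset_ax p; exists g; rewrite pE; exact: double_coset_refl. Qed.

Lemma dcoset_inj alpha beta (p q : dcoset alpha beta) :
  dcoset_set p = dcoset_set q -> p = q.
Proof.
by case: p q => [p pP] [q qP] /= pq; case: q / pq qP => qP; congr MkDcoset;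
  apply: Prop_irrelevance.
Qed.

Lemma product_exists alpha beta gamma (p : dcoset alpha beta)
  (q : dcoset beta gamma) : exists r, is_product p q r.
Proof.
have [[g pE] [g' qE]] := (dcoset_ax p, dcoset_ax q).
have [N NP] := theta_product_const alpha beta gamma g g'.
exists (@MkDcoset alpha gamma _ (ex_intro _ (theta_product beta g g' N) erefl)).
move=> p0 q0; rewrite pE qE /= => pp0 qq0.
have [M MP] := theta_product_indep pp0 qq0.
exists (N + M)%N => j jN.
by rewrite (MP j) ?NP //; lia.
Qed.

Lemma product_unique alpha beta gamma (p : dcoset alpha beta)
    (q : dcoset beta gamma) r r' : is_product p q r -> is_product p q r' -> r = r'.
Proof.
move=> rP r'P; have [[g pg] [g' qg']] := (dcoset_mem p, dcoset_mem q).
have [[N NP] [M MP]] := (rP _ _ pg qg', r'P _ _ pg qg').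
by apply: dcoset_inj; rewrite -(NP (N + M)%N) -?(MP (N + M)%N) //; lia.
Qed.

Definition dcprod alpha beta gamma (p : dcoset alpha beta)
    (q : dcoset beta gamma) : dcoset alpha gamma :=
  projT1 (cid (product_exists p q)).

Lemma dcprodP alpha beta gamma (p : dcoset alpha beta) (q : dcoset beta gamma) :
  is_product p q (dcprod p q).
Proof. exact: projT2 (cid _). Qed.

(* Gluing data.  The triangle t has the three sides (t, 0), (t, 1), (t, 2),
   listed clockwise from an arbitrary one.  The side s is glued to the side
   [glue s], always compatibly with the orientations.  Vertices are not part
   of the data: they are the cycles of corners obtained by crossing the edges
   one after the other, so that triangles are attached to each other only
   along edges. *)
Record complex (alpha beta : nat) := MkComplex {
  tri : eqType;
  plus : pred tri;
  glue : tri * 'I_3 -> tri * 'I_3;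
  side_color : tri * 'I_3 -> color;
  lab_plus : 'I_beta -> tri;
  lab_minus : 'I_alpha -> tri
}.
Arguments tri {alpha beta} c.
Arguments plus {alpha beta c} t.
Arguments glue {alpha beta c} s.
Arguments side_color {alpha beta c} s.
Arguments lab_plus {alpha beta} c k.
Arguments lab_minus {alpha beta} c k.

Definition turn (T : Type) (s : T * 'I_3) : T * 'I_3 := (s.1, ordS s.2).

(* The triangles of C satisfying A form a surface as in the definition of
   L[alpha, beta], possibly with infinitely many triangles.  By [surf_plus]
   no side is glued to itself, so each edge is incident to two triangles. *)
Record is_surface alpha beta (C : complex alpha beta) (A : pred (tri C)) : Prop :=
  IsSurface {
  surf_glue : forall s, A s.1 -> A (glue s).1;
  surf_glueK : forall s, A s.1 -> glue (glue s) = s;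
  surf_plus : forall s, A s.1 -> plus (glue s).1 = ~~ plus s.1;
  surf_color : forall s, A s.1 -> side_color (glue s) = side_color s;
  surf_clockwise : forall s, A s.1 -> plus s.1 ->
    side_color (turn s) = next_color (side_color s);
  surf_anticlockwise : forall s, A s.1 -> ~~ plus s.1 ->
    side_color s = next_color (side_color (turn s));
  surf_lab_plus : forall k, A (lab_plus C k) && plus (lab_plus C k);
  surf_lab_minus : forall k, A (lab_minus C k) && ~~ plus (lab_minus C k);
  surf_lab_plus_inj : injective (lab_plus C);
  surf_lab_minus_inj : injective (lab_minus C)
}.

Record surface (alpha beta : nat) := MkSurface {
  surface_complex :> complex alpha beta;
  surfaceP : is_surface (C := surface_complex) predT
}.

Definition sub_glue (T : eqType) (A : pred T) (f : T * 'I_3 -> T * 'I_3)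
    (fA : forall s, A s.1 -> A (f s).1) (s : {t | A t} * 'I_3) :
    {t | A t} * 'I_3 :=
  let s' := (val s.1, s.2) in
  (exist _ (f s').1 (fA s' (valP s.1)), (f s').2).

Definition restrict_complex alpha beta (C : complex alpha beta)
    (A : pred (tri C)) (CA : is_surface A) : complex alpha beta :=
  {| tri := {t | A t};
     plus t := plus (val t);
     glue := sub_glue (surf_glue CA);
     side_color s := side_color (val s.1, s.2);
     lab_plus k := exist _ (lab_plus C k) (andP (surf_lab_plus CA k)).1;
     lab_minus k := exist _ (lab_minus C k) (andP (surf_lab_minus CA k)).1 |}.

Lemma restrict_is_surface alpha beta (C : complex alpha beta)
    (A : pred (tri C)) (CA : is_surface A) :
  is_surface (C := restrict_complex CA) predT.
Proof.
split=> //=.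
- move=> [[t At] i] _; rewrite /sub_glue /=.
  have E := surf_glueK CA (s := (t, i)) At.
  congr (_, _); last by rewrite -surjective_pairing E.
  by apply: val_inj; rewrite /= -surjective_pairing E.
- by move=> [[t At] i] _; rewrite /= (surf_plus CA).
- by move=> [[t At] i] _; rewrite /= -surjective_pairing (surf_color CA).
- by move=> [[t At] i] _ /= tp; rewrite -(surf_clockwise CA (s := (t, i))).
- by move=> [[t At] i] _ /= tp; rewrite (surf_anticlockwise CA (s := (t, i))).
- by move=> k; case/andP: (surf_lab_plus CA k).
- by move=> k; case/andP: (surf_lab_minus CA k).
- by move=> k k' [/(surf_lab_plus_inj CA)].
- by move=> k k' [/(surf_lab_minus_inj CA)].
Qed.

Definition restrict alpha beta (C : complex alpha beta) (A : pred (tri C))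
    (CA : is_surface A) : surface alpha beta :=
  MkSurface (restrict_is_surface CA).

Section DoubleTriangles.
Context (alpha beta : nat) (C : complex alpha beta).

(* t is glued to one other triangle along their whole perimeters: all three
   vertices of t have valency two. *)
Definition double_triangle (t : tri C) : bool :=
  [forall i : 'I_3, turn (glue (turn (t, i))) == glue (t, i)].

(* The other triangle of the component, when t lies in a double triangle. *)
Definition opposite (t : tri C) : tri C := (glue (t, ord0)).1.

Definition labelled (t : tri C) : bool :=
  [exists k, lab_plus C k == t] || [exists k, lab_minus C k == t].

Definition unlabelled_double (t : tri C) : bool :=
  [&& double_triangle t, ~~ labelled t & ~~ labelled (opposite t)].

End DoubleTriangles.

(* Elements of L[alpha, beta], before passing to equivalence classes. *)
Record L (alpha beta : nat) := MkL {
  L_surface :> surface alpha beta;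
  L_compact : exists ts : seq (tri L_surface), forall t, t \in ts;
  L_labels : forall t : tri L_surface, ~~ unlabelled_double t
}.

(* Combinatorial equivalence: f acts on triangles, phi on sides. *)
Definition equivalent alpha beta (C C' : complex alpha beta) : Prop :=
  exists (f : tri C -> tri C') (phi : tri C * 'I_3 -> tri C' * 'I_3),
  [/\ bijective f,
      bijective phi,
      (forall s, (phi s).1 = f s.1) /\ (forall s, phi (turn s) = turn (phi s)),
      forall s, phi (glue s) = glue (phi s) &
      [/\ forall t, plus (f t) = plus t,
          forall s, side_color (phi s) = side_color s,
          forall k, f (lab_plus C k) = lab_plus C' k &
          forall k, f (lab_minus C k) = lab_minus C' k]].

Lemma ordS3 (i : 'I_3) : ordS (ordS (ordS i)) = i.
Proof. by apply: val_inj; case: i => [[|[|[|]]]]. Qed.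

Lemma turn3 (T : Type) (s : T * 'I_3) : turn (turn (turn s)) = s.
Proof. by case: s => t i; rewrite /turn /= ordS3. Qed.

Lemma side_ind (T : Type) (s : T * 'I_3) i :
  [\/ (s.1, i) = s, (s.1, i) = turn s | (s.1, i) = turn (turn s)].
Proof.
case: s => t j; rewrite /turn /=; have: [\/ i = j, i = ordS j | i = ordS (ordS j)].
  case: i j => [[|[|[|//]]] ?] [[|[|[|//]]] ?];
  by [apply: Or31; apply: val_inj|apply: Or32; apply: val_inj|apply: Or33; apply: val_inj].
by case=> ->; [apply: Or31|apply: Or32|apply: Or33].
Qed.

Lemma double_triangleP alpha beta (C : complex alpha beta) (t : tri C) :
  reflect (forall s, s.1 = t -> turn (glue (turn s)) = glue s) (double_triangle t).
Proof.
apply: (iffP forallP) => [H [t' i] /= ->|H i]; first exact/eqP.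
by rewrite H.
Qed.

Lemma double_side alpha beta (C : complex alpha beta) (t : tri C) s :
  double_triangle t -> s.1 = t -> (glue s).1 = opposite t.
Proof.
move=> /double_triangleP dt st.
have H (x : tri C * 'I_3) : x.1 = t -> (glue (turn x)).1 = (glue x).1.
  by move=> xt; rewrite -(dt x xt).
rewrite /opposite -st; have := side_ind s ord0.
by case=> ->; rewrite ?H.
Qed.

Section Discard.
Context (alpha beta : nat) (S : surface alpha beta).

Let gK : involutive (@glue _ _ S).
Proof. by move=> s; rewrite (surf_glueK (surfaceP S)). Qed.

Lemma double_opposite (t : tri S) s : double_triangle t -> (glue s).1 = t ->
  double_triangle s.1.
Proof.
move=> dt; have /double_triangleP dt' := dt.
have key (x : tri S * 'I_3) : x.1 = t -> turn (glue (turn (glue x))) = x.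
  move=> xt; have := dt' (turn (turn x)) xt; rewrite turn3 => ->.
  by rewrite gK turn3.
move=> gs; apply/double_triangleP => -[u i] /= us.
have [y yt <-] : exists2 y, y.1 = t & glue y = (u, i).
  exists (glue (u, i)); last exact: gK.
  have E1 : turn (glue (turn (glue s))) = s by rewrite dt' ?gK.
  have E2 : glue (turn (glue s)) = turn (turn s) by rewrite -{2}E1 turn3.
  have E3 : glue (turn (turn (glue s))) = turn s.
    by rewrite -[LHS]turn3 dt' // E2 !turn3.
  rewrite us; have := side_ind s i; case=> ->; first exact: gs.
    by rewrite -E3 gK.
  by rewrite -E2 gK.
by rewrite gK; apply: key.
Qed.

Lemma unlabelled_double_glue s :
  @unlabelled_double _ _ S (glue s).1 -> @unlabelled_double _ _ S s.1.
Proof.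
move=> /and3P[dt nl nl'].
have ds : double_triangle s.1 by exact: double_opposite dt erefl.
apply/and3P; split=> //; last by rewrite -(double_side ds erefl).
by rewrite -[s]gK (double_side dt).
Qed.

Lemma discard_is_surface :
  is_surface (C := S) [pred t | ~~ unlabelled_double t].
Proof.
have SP := surfaceP S; split; try by case: SP => *; auto.
- by move=> s; apply/contra/unlabelled_double_glue.
- move=> k; rewrite inE; have /andP[_ ->] := surf_lab_plus SP k.
  rewrite andbT; apply/negP => /and3P[_ /negP[]].
  by apply/orP; left; apply/existsP; exists k.
- move=> k; rewrite inE; have /andP[_ ->] := surf_lab_minus SP k.
  rewrite andbT; apply/negP => /and3P[_ /negP[]].
  by apply/orP; right; apply/existsP; exists k.
Qed.

Definition discard : surface alpha beta := restrict discard_is_surface.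

Lemma discard_labels (t : tri discard) : ~~ unlabelled_double t.
Proof.
have lE (u : tri discard) : labelled u = labelled (val u).
  by congr orb; apply: eq_existsb => k; rewrite -val_eqE.
apply: contra (valP t) => /and3P[dt]; rewrite !lE => nl nl'.
exact/and3P.
Qed.

End Discard.

(* The i-th side, clockwise, of a plus-triangle or a minus-triangle. *)
Definition color_at (b : bool) (i : 'I_3) : color :=
  nth Red (if b then [:: Red; Yellow; Blue] else [:: Red; Blue; Yellow]) i.

Definition position (b : bool) (c : color) : 'I_3 :=
  match c with
  | Red => inord 0
  | Yellow => if b then inord 1 else inord 2
  | Blue => if b then inord 2 else inord 1
  end.

Lemma position_color b i : position b (color_at b i) = i.
Proof. by apply: val_inj; case: b i => [] [[|[|[|//]]] ?]; rewrite /= inordK. Qed.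

Lemma color_position b c : color_at b (position b c) = c.
Proof. by case: b c => [] []; rewrite /color_at /= inordK. Qed.

(* (true, k) is the k-th plus-triangle, (false, l) the l-th minus-triangle. *)
Definition G_glue (g : G) (s : (bool * nat) * 'I_3) : (bool * nat) * 'I_3 :=
  let: ((b, n), i) := s in
  let c := color_at b i in
  ((~~ b, if b then component g c n else (component g c)^-1 n),
   position (~~ b) c).

Definition G_complex (alpha beta : nat) (g : G) : complex alpha beta :=
  {| tri := (bool * nat)%type;
     plus t := t.1;
     glue := G_glue g;
     side_color s := color_at s.1.1 s.2;
     lab_plus k := (true, val k);
     lab_minus k := (false, val k) |}.

Lemma G_is_surface alpha beta g : is_surface (C := G_complex alpha beta g) predT.
Proof.
split=> //=.
- move=> [[b n] i] _; rewrite /= negbK color_position position_color.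
  by case: b; rewrite /= ?sinf_funK ?sinf_inv_funK.
- by move=> [[b n] i] _.
- by move=> [[b n] i] _; rewrite /= color_position.
- by move=> [[[] n] [[|[|[|//]]] ?]] _.
- by move=> [[[] n] [[|[|[|//]]] ?]] _.
- by move=> k k' [/val_inj].
- by move=> k k' [/val_inj].
Qed.

Definition G_surface alpha beta (g : G) : surface alpha beta :=
  MkSurface (G_is_surface alpha beta g).

Lemma G_compact alpha beta (g : G) :
  exists ts : seq (tri (discard (G_surface alpha beta g))), forall t, t \in ts.
Proof.
have [N gN] := G_bound g.
pose M := (N + alpha + beta)%N.
exists (pmap insub
  ([seq (true, n) | n <- iota 0 M] ++ [seq (false, n) | n <- iota 0 M])).
move=> t; rewrite mem_pmap_sub; case: t => -[b n] /= bn.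
suff nM : n < M.
  by rewrite mem_cat; case: b {bn}; rewrite map_f ?orbT ?mem_iota.
rewrite ltnNge; apply: contra bn => Mn.
have gE c : (component g c) n = n by apply: gN; lia.
have gVE c : ((component g c)^-1)%g n = n by rewrite -[in LHS](gE c) sinfK.
have glE b' i : G_glue g ((b', n), i) =
    ((~~ b', n), position (~~ b') (color_at b' i)).
  by case: b'; congr ((_, _), _); [exact: gE|exact: gVE].
have nl b' : ~~ @labelled _ _ (G_complex alpha beta g) (b', n).
  apply/norP; split; apply/existsP => -[[k kP] /= /eqP[_ kn]]; lia.
apply/and3P; split=> //; last first.
  by rewrite /opposite [glue _]glE; exact: nl.
apply/forallP => i; apply/eqP.
change (turn (G_glue g (turn ((b, n), i))) = G_glue g ((b, n), i)).
rewrite /turn !glE.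
congr (_, _); apply: val_inj.
by case: (b) i => [] [[|[|[|//]]] ?]; rewrite /= !inordK.
Qed.

Definition surface_of alpha beta (g : G) : L alpha beta :=
  MkL (G_compact alpha beta g) (@discard_labels _ _ _).

Section Gluing.
Context (alpha beta gamma : nat) (P : surface alpha beta) (Q : surface beta gamma).

(* The triangles that remain once iota^+_P(k) and iota^-_Q(k) are removed. *)
Definition remaining (u : tri P + tri Q) : bool :=
  match u with
  | inl t => ~~ [exists k, lab_plus P k == t]
  | inr t => ~~ [exists k, lab_minus Q k == t]
  end.

Definition side_of_color a b (C : complex a b) (t : tri C) (c : color) :
    tri C * 'I_3 :=
  (t, odflt ord0 [pick i | side_color (t, i) == c]).

Definition inl_side (s : tri P * 'I_3) : (tri P + tri Q) * 'I_3 := (inl s.1, s.2).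
Definition inr_side (s : tri Q * 'I_3) : (tri P + tri Q) * 'I_3 := (inr s.1, s.2).

(* A remaining side of P that was glued to a side of iota^+_P(k) lies on the
   boundary of the k-th hole of P; it is glued to the side of Q lying on the
   boundary of the k-th hole of Q along the edge of the same color.  Since
   vertices are not recorded, they are not pasted together.  The values on
   the removed triangles are irrelevant. *)
Definition paste (s : (tri P + tri Q) * 'I_3) : (tri P + tri Q) * 'I_3 :=
  match s with
  | (inl t, i) =>
      let s' := glue (t, i) in
      if [pick k | lab_plus P k == s'.1] is Some k
      then inr_side (glue (side_of_color (lab_minus Q k) (side_color s')))
      else inl_side s'
  | (inr t, i) =>
      let s' := glue (t, i) in
      if [pick k | lab_minus Q k == s'.1] is Some k
      then inl_side (glue (side_of_color (lab_plus P k) (side_color s')))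
      else inr_side s'
  end.

Definition paste_complex : complex alpha gamma :=
  {| tri := (tri P + tri Q)%type;
     plus u := match u with inl t => plus t | inr t => plus t end;
     glue := paste;
     side_color s := match s with
                     | (inl t, i) => side_color (t, i)
                     | (inr t, i) => side_color (t, i)
                     end;
     lab_plus k := inr (lab_plus Q k);
     lab_minus k := inl (lab_minus P k) |}.

End Gluing.

Lemma side_of_colorE a b (S : surface a b) (t : tri S) (c : color) :
  side_color (side_of_color t c) = c.
Proof.
rewrite /side_of_color; case: pickP => [i /eqP //|/= H].
have SP := surfaceP S.
have := H (ordS (ordS ord0)); have := H (ordS ord0); have := H ord0.
case: (boolP (plus t)) => tp.
  have E := fun i => surf_clockwise SP (s := (t, i)) isT tp.
  have := E (ordS ord0); rewrite /turn /= => ->; have := E ord0.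
  by rewrite /turn /= => ->; case: (side_color _) c {H E} => [] [].
have E := fun i => surf_anticlockwise SP (s := (t, i)) isT tp.
rewrite (E ord0) (E (ordS ord0)) /turn /=.
by case: (side_color _) c {H E} => [] [].
Qed.

Lemma side_of_color_uniq a b (S : surface a b) (s s' : tri S * 'I_3) :
  s.1 = s'.1 -> side_color s = side_color s' -> s = s'.
Proof.
have SP := surfaceP S => ss'.
have next1 c : next_color c <> c by case: c.
have next2 c : next_color (next_color c) <> c by case: c.
have s'E : s' = (s.1, s'.2) by rewrite ss' -surjective_pairing.
have [E|E|E] := side_ind s s'.2; rewrite E in s'E; rewrite s'E => {ss' s'E E s'}.
- by [].
- case: (boolP (plus s.1)) => sp.
    by rewrite (surf_clockwise SP (s := s)) // => /esym/next1.
  by rewrite (surf_anticlockwise SP (s := s)) // => /next1.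
- case: (boolP (plus s.1)) => sp.
    by rewrite !(surf_clockwise SP) // => /esym/next2.
  by rewrite (surf_anticlockwise SP (s := s)) //
    (surf_anticlockwise SP (s := turn s)) // => /next2.
Qed.

Lemma side_of_color_eq a b (S : surface a b) (s : tri S * 'I_3) t :
  t = s.1 -> side_of_color t (side_color s) = s.
Proof.
by move=> ts; apply: side_of_color_uniq => //; rewrite side_of_colorE.
Qed.

Lemma pick_inj n (T : eqType) (f : 'I_n -> T) k :
  injective f -> [pick k' | f k' == f k] = Some k.
Proof.
move=> fi; case: pickP => [k' /eqP/fi -> //|/(_ k)]; by rewrite eqxx.
Qed.

Lemma paste_is_surface alpha beta gamma (P : surface alpha beta)
    (Q : surface beta gamma) :
  is_surface (C := paste_complex P Q) (@remaining _ _ _ P Q).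
Proof.
have [SP SQ] := (surfaceP P, surfaceP Q).
have lpP k : plus (lab_plus P k) by case/andP: (surf_lab_plus SP k).
have lmP k : ~~ plus (lab_minus P k) by case/andP: (surf_lab_minus SP k).
have lpQ k : plus (lab_plus Q k) by case/andP: (surf_lab_plus SQ k).
have lmQ k : ~~ plus (lab_minus Q k) by case/andP: (surf_lab_minus SQ k).
split.
- move=> [[t|t] i] /= tr; case: pickP => [k /eqP ks|ks] /=.
  + apply/negP => /existsP[k' /eqP k'E]; have := lmQ k'.
    by rewrite k'E (surf_plus SQ) // lmQ.
  + by apply/negP => /existsP[k']; rewrite ks.
  + apply/negP => /existsP[k' /eqP k'E]; have := lpP k'.
    by rewrite k'E (surf_plus SP) // lpP.
  + by apply/negP => /existsP[k']; rewrite ks.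
- have nt a b (C : complex a b) (x : tri C) (m : nat) (l : 'I_m -> tri C) :
    ~~ [exists k, l k == x] -> [pick k | l k == x] = None.
    by move=> H; case: pickP => // k kE; case/existsP: H; exists k.
  move=> [[t|t] i] /= tr; case: pickP => [k /eqP ks|ks] /=.
  + rewrite -surjective_pairing (surf_glueK SQ) //= pick_inj; last first.
      exact: surf_lab_minus_inj SQ.
    by rewrite side_of_colorE side_of_color_eq // (surf_glueK SP).
  + by rewrite -surjective_pairing (surf_glueK SP) //= nt.
  + rewrite -surjective_pairing (surf_glueK SP) //= pick_inj; last first.
      exact: surf_lab_plus_inj SP.
    by rewrite side_of_colorE side_of_color_eq // (surf_glueK SQ).
  + by rewrite -surjective_pairing (surf_glueK SQ) //= nt.
- move=> [[t|t] i] /= tr; case: pickP => [k /eqP ks|ks] /=.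
  + have := surf_plus SP (s := (t, i)) isT; rewrite -ks lpP /= => <-.
    by rewrite (surf_plus SQ) //= (negbTE (lmQ k)).
  + by rewrite (surf_plus SP).
  + have := surf_plus SQ (s := (t, i)) isT; rewrite -ks (negbTE (lmQ k)) /= => <-.
    by rewrite (surf_plus SP) //= lpP.
  + by rewrite (surf_plus SQ).
- move=> [[t|t] i] /= tr; case: pickP => [k /eqP ks|ks] /=;
    rewrite -surjective_pairing.
  + by rewrite (surf_color SQ) // side_of_colorE (surf_color SP).
  + by rewrite (surf_color SP).
  + by rewrite (surf_color SP) // side_of_colorE (surf_color SQ).
  + by rewrite (surf_color SQ).
- move=> [[t|t] i] /= tr tp.
  + by rewrite -(surf_clockwise SP (s := (t, i))).
  + by rewrite -(surf_clockwise SQ (s := (t, i))).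
- move=> [[t|t] i] /= tr tp.
  + by rewrite (surf_anticlockwise SP (s := (t, i))).
  + by rewrite (surf_anticlockwise SQ (s := (t, i))).
- move=> k; rewrite /= lpQ andbT; apply/negP => /existsP[k' /eqP E].
  by have := lmQ k'; rewrite E lpQ.
- move=> k; rewrite /= lmP andbT; apply/negP => /existsP[k' /eqP E].
  by have := lmP k; rewrite -E lpP.
- by move=> k k' [/(surf_lab_plus_inj SQ)].
- by move=> k k' [/(surf_lab_minus_inj SP)].
Qed.

Definition paste_surface alpha beta gamma (P : surface alpha beta)
    (Q : surface beta gamma) : surface alpha gamma :=
  restrict (paste_is_surface P Q).

Lemma restrict_compact alpha beta (C : complex alpha beta) (A : pred (tri C))
    (CA : is_surface A) :
    (exists ts : seq (tri C), forall t, t \in ts) ->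
  exists ts : seq (tri (restrict CA)), forall t, t \in ts.
Proof.
by move=> [ts tsP]; exists (pmap insub ts) => t; rewrite mem_pmap_sub.
Qed.

Lemma gluing_compact alpha beta gamma (P : L alpha beta) (Q : L beta gamma) :
  exists ts : seq (tri (discard (paste_surface P Q))), forall t, t \in ts.
Proof.
apply: (restrict_compact (C := paste_surface P Q)).
apply: (restrict_compact (C := paste_complex P Q)).
have [[ps psP] [qs qsP]] := (L_compact P, L_compact Q).
exists (map inl ps ++ map inr qs) => -[t|t]; rewrite mem_cat.
  by rewrite map_f.
by rewrite orbC map_f.
Qed.

Definition gluing alpha beta gamma (P : L alpha beta) (Q : L beta gamma) :
    L alpha gamma :=
  MkL (gluing_compact P Q) (@discard_labels _ _ _).

Lemma equivalent_refl alpha beta (C : complex alpha beta) : equivalent C C.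
Proof. by exists id, id; split=> //; exists id. Qed.

Lemma equivalent_sym alpha beta (C C' : complex alpha beta) :
  equivalent C C' -> equivalent C' C.
Proof.
move=> [f [phi [[f' fK f'K] [phi' pK p'K] [pf pt] pg [fp pc flp flm]]]].
exists f', phi'; split; [by exists f|by exists phi| | |].
- split=> s; first by rewrite -{2}[s]p'K pf fK.
  by apply: (can_inj pK); rewrite pt !p'K.
- by move=> s; apply: (can_inj pK); rewrite pg !p'K.
- split.
  + by move=> t; rewrite -fp f'K.
  + by move=> s; rewrite -pc p'K.
  + by move=> k; rewrite -flp fK.
  + by move=> k; rewrite -flm fK.
Qed.

Lemma equivalent_trans alpha beta (C1 C2 C3 : complex alpha beta) :
  equivalent C1 C2 -> equivalent C2 C3 -> equivalent C1 C3.
Proof.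
move=> [f [phi [fb pb [pf pt] pg [fp pc flp flm]]]].
move=> [f' [phi' [fb' pb' [pf' pt'] pg' [fp' pc' flp' flm']]]].
exists (f' \o f), (phi' \o phi); split; [exact: bij_comp|exact: bij_comp| | |].
- by split=> s /=; rewrite ?pf' ?pf // pt pt'.
- by move=> s /=; rewrite pg pg'.
- split=> x /=.
  + by rewrite fp' fp.
  + by rewrite pc' pc.
  + by rewrite flp flp'.
  + by rewrite flm flm'.
Qed.

Lemma equivalent_discard alpha beta (S S' : surface alpha beta) :
  equivalent S S' -> equivalent (discard S) (discard S').
Proof.
move=> [f [phi [fb pb [pf pt] pg [fp pc flp flm]]]].
have finj := bij_inj fb; have pinj := bij_inj pb.
have dE (t : tri S) : double_triangle (f t) = double_triangle t.
  apply/double_triangleP/double_triangleP => H s st.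
    by apply: pinj; rewrite pt !pg pt H // pf st.
  have [psi pK psiK] := pb; rewrite -[s]psiK -pt -!pg -pt H //.
  by apply: finj; rewrite -pf psiK.
have lE (t : tri S) : labelled (f t) = labelled t.
  congr orb; apply: eq_existsb => k.
    by rewrite -flp (inj_eq finj).
  by rewrite -flm (inj_eq finj).
have oE (t : tri S) : double_triangle t -> opposite (f t) = f (opposite t).
  move=> dt; have <- : (glue (phi (t, ord0))).1 = opposite (f t).
    by apply: double_side; rewrite ?dE // pf.
  by rewrite -pg pf.
have uE (t : tri S) : unlabelled_double (f t) = unlabelled_double t.
  rewrite /unlabelled_double dE lE.
  by case: (boolP (double_triangle t)) => //= /oE ->; rewrite lE.
have FP (t : tri (discard S)) : ~~ unlabelled_double (f (val t)).
  by rewrite uE; exact: (valP t).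
pose F (t : tri (discard S)) : tri (discard S') := exist _ (f (val t)) (FP t).
pose Phi (s : tri (discard S) * 'I_3) : tri (discard S') * 'I_3 :=
  (F s.1, (phi (val s.1, s.2)).2).
have [f' fK f'K] := fb; have [psi pK psiK] := pb.
have F'P (t : tri (discard S')) : ~~ unlabelled_double (f' (val t)).
  by rewrite -uE f'K; exact: (valP t).
pose F' (t : tri (discard S')) : tri (discard S) := exist _ (f' (val t)) (F'P t).
have psi1 s : (psi s).1 = f' s.1 by rewrite -{2}[s]psiK pf fK.
pose Psi (s : tri (discard S') * 'I_3) : tri (discard S) * 'I_3 :=
  (F' s.1, (psi (val s.1, s.2)).2).
have PhiE s : (val (Phi s).1, (Phi s).2) = phi (val s.1, s.2).
  by rewrite /Phi /= [RHS]surjective_pairing pf.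
have PsiE s : (val (Psi s).1, (Psi s).2) = psi (val s.1, s.2).
  by rewrite /Psi /= [RHS]surjective_pairing psi1.
have side_inj (C : surface alpha beta) (s s' : tri (discard C) * 'I_3) :
    (val s.1, s.2) = (val s'.1, s'.2) -> s = s'.
  by case: s s' => [t i] [t' i'] /= [/val_inj -> ->].
have glueE (C : surface alpha beta) (s : tri (discard C) * 'I_3) :
    (val (glue s).1, (glue s).2) = glue (val s.1, s.2).
  by rewrite /= -surjective_pairing.
exists F, Phi; split.
- by exists F' => t; apply: val_inj; rewrite /= ?fK ?f'K.
- exists Psi => s; apply: side_inj; first by rewrite PsiE PhiE pK.
  by rewrite PhiE PsiE psiK.
- split=> // s; apply: side_inj.
  transitivity (turn (val (Phi s).1, (Phi s).2)) => //.
  by rewrite !PhiE -pt.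
- by move=> s; apply: side_inj; rewrite PhiE !glueE PhiE pg.
- split.
  + by move=> t; rewrite /= fp.
  + move=> s; change (side_color (val (Phi s).1, (Phi s).2) =
      side_color (val s.1, s.2)).
    by rewrite PhiE pc.
  + by move=> k; apply: val_inj; rewrite /= flp.
  + by move=> k; apply: val_inj; rewrite /= flm.
Qed.

Lemma G_surface_double_coset alpha beta (g g' : G) :
    double_coset alpha beta g g' ->
  equivalent (G_surface alpha beta g) (G_surface alpha beta g').
Proof.
move=> [_ [_ [[k kK <-] [h hK <-] ->]]].
pose f (t : bool * nat) : bool * nat :=
  (t.1, if t.1 then h^-1%g t.2 else k t.2).
pose f' (t : bool * nat) : bool * nat :=
  (t.1, if t.1 then h t.2 else k^-1%g t.2).
have fK : cancel f f'.
  by move=> [[] n]; congr (_, _); [exact: sinfVK|exact: sinfK].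
have f'K : cancel f' f.
  by move=> [[] n]; congr (_, _); [exact: sinfK|exact: sinfVK].
exists f, (fun s => (f s.1, s.2)); split.
- by exists f'.
- by exists (fun s => (f' s.1, s.2)) => -[t i]; congr (_, _);
    [exact: fK|exact: f'K].
- by split.
- move=> [[b n] i]; case: b; congr ((_, _), _).
    change (k (component g (color_at true i) n) =
      component (diagonal k * g * diagonal h) (color_at true i) (h^-1%g n)).
    by rewrite !componentM; case: (color_at true i); rewrite !sinfM sinfVK.
  change (h^-1%g ((component g (color_at false i))^-1%g n) =
    (component (diagonal k * g * diagonal h) (color_at false i))^-1%g (k n)).
  rewrite !componentM !invgM !sinfM.
  by case: (color_at false i); rewrite [k^-1%g (k n)]sinfK.
- split=> // i; congr (_, _).
    change ((h^-1)%g (val i) = val i).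
    by apply: (@sinf_inj h); rewrite sinfVK; exact/esym/hK/ltn_ord.
  change (k (val i) = val i); exact/kK/ltn_ord.
Qed.

Definition corresponds alpha beta (p : dcoset alpha beta) (P : L alpha beta) :
    Prop :=
  exists2 g, dcoset_set p g & equivalent (surface_of alpha beta g) P.

Lemma corresponds_all alpha beta (p : dcoset alpha beta) (P : L alpha beta) :
  corresponds p P <->
  forall g, dcoset_set p g -> equivalent (surface_of alpha beta g) P.
Proof.
split=> [[g pg gP] g' pg'|H]; last first.
  by have [g pg] := dcoset_mem p; exists g; last exact: H.
apply: equivalent_trans gP; apply: equivalent_discard.
have [g0 pE] := dcoset_ax p; move: pg pg'; rewrite pE => g0g g0g'.
exact: equivalent_trans (equivalent_sym (G_surface_double_coset g0g'))
  (G_surface_double_coset g0g).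
Qed.

(* Main.v *)
Require Import Defs.
From mathcomp Require Import all_boot zify.
From mathcomp Require Import boolp.

(** A surface of the kind considered here carries the same information as a
    set of signed triangles with three involutions, [neighbour _ c], that
    cross the side of color c: the sign of a triangle determines the cyclic
    order of the colors of its sides, so positions of sides can be forgotten
    ([equivalent_neighbour]).

    Choose g in the first coset and h in the second, both supported in
    [0, N), and j at least N and large enough for r = g theta_j h to represent
    the product.  Crossing the c-side of the n-th plus-triangle of r means
    applying h_c, then theta_j, then g_c.  If n < beta + j, start from the n-th
    plus-triangle of the surface of h and go to its minus-triangle number
    m = h_c n.  If m < beta, this minus-triangle is removed by the gluing,
    theta_j fixes m, and one continues through the m-th hole to the
    minus-triangle g_c m of the surface of g, which is what [paste]
    prescribes.  If m >= beta, theta_j moves m to m + j, out of reach of g,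
    and m + j is just another name of the m-th minus-triangle of the surface
    of h.  If beta + j <= n < beta + 2j, then h fixes n, theta_j brings it to
    n - j, and one crosses from the plus-triangle n - j of the surface of g.
    So theta_j makes room for disjoint copies of the triangles that survive the
    gluing, and the surface of r agrees with the gluing of the surfaces of g
    and h ([theta_productE], [theta_embedding_essential]).

    This agreement misses infinitely many unlabelled double triangles on both
    sides, and the gluing has to be formed from surfaces where such components
    have already been discarded.  Both points are handled by one notion: an
    [essential_embedding] embeds a surface in another and misses only
    unlabelled double triangles.  It induces an equivalence after discarding
    ([essential_embedding_discard]); combinatorial equivalences and the
    inclusions of subsurfaces with such a complement are examples; and pasting
    is functorial for it ([paste_essential_embedding]), because the removed
    triangles are labelled, so that no unlabelled double triangle meets a
    hole. *)

Set Implicit Arguments.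
Unset Strict Implicit.
Unset Printing Implicit Defensive.

(** * Surfaces as colored graphs *)

Definition neighbour a b (C : complex a b) (t : tri C) (c : color) : tri C :=
  (glue (side_of_color t c)).1.

Lemma next_color_inj : injective next_color.
Proof. by case=> [] []. Qed.

Section Neighbours.
Context (a b : nat) (S : surface a b).
Let SP := surfaceP S.

Lemma glue_neighbour (s : tri S * 'I_3) :
  (glue s).1 = neighbour s.1 (side_color s).
Proof. by rewrite /neighbour side_of_color_eq. Qed.

Lemma glue_side_of_color (t : tri S) c :
  glue (side_of_color t c) = side_of_color (neighbour t c) c.
Proof.
by apply: side_of_color_uniq => //; rewrite (surf_color SP) // !side_of_colorE.
Qed.

Lemma neighbourK c : involutive (fun t : tri S => neighbour t c).
Proof.
by move=> t /=; rewrite {1}/neighbour -glue_side_of_color (surf_glueK SP).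
Qed.

Lemma plus_neighbour (t : tri S) c : plus (neighbour t c) = ~~ plus t.
Proof. by rewrite /neighbour (surf_plus SP). Qed.

(** If all sides of t lead to the same triangle, the gluing is forced on the
    sides by their colors; the two triangles have opposite signs, hence
    opposite cyclic orders of colors, which gives valency two at the
    vertices. *)
Lemma double_neighbourP (t : tri S) :
  reflect (forall c, neighbour t c = opposite t) (double_triangle t).
Proof.
apply: (iffP idP) => [dt c|nt]; first exact: double_side dt _.
apply/double_triangleP => s st; apply: side_of_color_uniq.
  by rewrite /turn !glue_neighbour /= st !nt.
have e (x : tri S * 'I_3) : side_color (glue x) = side_color x.
  exact: (surf_color SP).
have p (x : tri S * 'I_3) : plus (glue x).1 = ~~ plus x.1.
  exact: (surf_plus SP).
case: (boolP (plus s.1)) => sp.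
  apply: next_color_inj; rewrite -(surf_anticlockwise SP) // ?p ?sp // !e.
  exact: (surf_clockwise SP).
by rewrite (surf_clockwise SP) // ?p // !e -(surf_anticlockwise SP).
Qed.

(** Unlike [opposite], which depends on which side is numbered 0, the triangle
    u below is transported by every map that preserves neighbours. *)
Lemma unlabelled_doubleP (t : tri S) :
  reflect (exists u, [/\ forall c, neighbour t c = u, ~~ labelled t
                       & ~~ labelled u])
          (unlabelled_double t).
Proof.
apply: (iffP and3P) => [[/double_neighbourP nt lt lo]|[u [nt lt lu]]].
  by exists (opposite t).
have ou : opposite t = u by rewrite /opposite glue_neighbour.
by split; rewrite ?ou //; apply/double_neighbourP => c; rewrite nt.
Qed.

End Neighbours.

(** The map on sides has to send a side to the side of the same color; it
    commutes with [turn] because signs fix the cyclic order of the colors. *)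
Lemma equivalent_neighbour a b (S T : surface a b) (f : tri S -> tri T) :
    bijective f ->
    (forall t, plus (f t) = plus t) ->
    (forall t c, f (neighbour t c) = neighbour (f t) c) ->
    (forall k, f (lab_plus S k) = lab_plus T k) ->
    (forall k, f (lab_minus S k) = lab_minus T k) ->
  equivalent S T.
Proof.
move=> [f' fK f'K] fp fn flp flm.
pose phi (s : tri S * 'I_3) := side_of_color (f s.1) (side_color s).
pose psi (s : tri T * 'I_3) := side_of_color (f' s.1) (side_color s).
exists f, phi; split; [by exists f'| | | |].
- exists psi => s; apply: side_of_color_uniq; rewrite ?side_of_colorE //=.
- split=> // s; apply: side_of_color_uniq => //.
  rewrite side_of_colorE; case: (boolP (plus s.1)) => sp.
    by rewrite !(surf_clockwise (surfaceP _)) ?side_of_colorE //= fp.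
  apply: next_color_inj; rewrite -!(surf_anticlockwise (surfaceP _)) //=.
    by rewrite side_of_colorE.
  by rewrite fp.
- move=> s; rewrite /phi glue_side_of_color glue_neighbour fn.
  by rewrite (surf_color (surfaceP S)).
- by split=> // s; rewrite side_of_colorE.
Qed.

(** * Essential embeddings *)

Record essential_embedding a b (S T : surface a b) (f : tri S -> tri T) :
  Prop := EssentialEmbedding {
  emb_inj : injective f;
  emb_plus : forall t, plus (f t) = plus t;
  emb_neighbour : forall t c, f (neighbour t c) = neighbour (f t) c;
  emb_lab_plus : forall k, f (lab_plus S k) = lab_plus T k;
  emb_lab_minus : forall k, f (lab_minus S k) = lab_minus T k;
  emb_essential : forall u, ~~ unlabelled_double u -> exists t, f t = u
}.

(** Every edge separates a plus-triangle from a minus-triangle, so it is enough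
    to look at it from the plus side. *)
Lemma neighbour_plus_suffices a b (S T : surface a b) (f : tri S -> tri T) :
    (forall t, plus (f t) = plus t) ->
    (forall t c, plus t -> f (neighbour t c) = neighbour (f t) c) ->
  forall t c, f (neighbour t c) = neighbour (f t) c.
Proof.
move=> fp fn t c; case: (boolP (plus t)) => tp; first exact: fn.
have /= tK := neighbourK c t.
rewrite -[in RHS]tK (fn (neighbour t c)) ?plus_neighbour //.
exact: (esym (neighbourK c _)).
Qed.

Section EssentialEmbeddings.
Context (a b : nat) (S T : surface a b).

Lemma emb_unlabelled_double (f : tri S -> tri T) t : essential_embedding f ->
  unlabelled_double (f t) = unlabelled_double t.
Proof.
case=> fi _ fn flp flm _.
have lE (u : tri S) : labelled (f u) = labelled u.
  by congr orb; apply: eq_existsb => k; rewrite -?flp -?flm (inj_eq fi).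
apply/unlabelled_doubleP/unlabelled_doubleP => -[u [nt lt lu]].
  exists (neighbour t Red); split=> [c||]; first by apply: fi; rewrite !fn !nt.
    by rewrite -lE.
  by rewrite -lE fn nt.
by exists (f u); split=> [c||]; rewrite -?fn ?nt ?lE.
Qed.

(** Being an unlabelled double triangle is detected through an essential
    embedding, so it restricts to the triangles that are kept, and there it is
    onto. *)
Lemma essential_embedding_discard (f : tri S -> tri T) :
  essential_embedding f -> equivalent (discard S) (discard T).
Proof.
move=> fE; have [fi fp fn flp flm fs] := fE.
have FP (t : tri (discard S)) : ~~ unlabelled_double (f (val t)).
  by rewrite (emb_unlabelled_double _ fE); exact: (valP t).
pose F (t : tri (discard S)) : tri (discard T) := exist _ (f (val t)) (FP t).
have F'P (u : tri (discard T)) :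
    ~~ unlabelled_double (projT1 (cid (fs _ (valP u)))).
  rewrite -(emb_unlabelled_double _ fE) (projT2 (cid (fs _ (valP u)))).
  exact: (valP u).
apply: (@equivalent_neighbour _ _ _ _ F).
- exists (fun u => exist _ (projT1 (cid (fs _ (valP u)))) (F'P u)) => u.
    by apply: val_inj; apply: fi => /=; rewrite (projT2 (cid (fs _ _))).
  by apply: val_inj; rewrite /= (projT2 (cid (fs _ _))).
- by move=> t /=; rewrite fp.
- by move=> t c; apply: val_inj; exact: fn.
- by move=> k; apply: val_inj; rewrite /= flp.
- by move=> k; apply: val_inj; rewrite /= flm.
Qed.

Lemma equivalent_essential_embedding : equivalent S T ->
  exists f : tri S -> tri T, essential_embedding f.
Proof.
move=> [f [phi [[f' fK f'K] _ [pf _] pg [fp pc flp flm]]]]; exists f.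
split=> //.
- exact: can_inj fK.
- move=> t c; rewrite {1}/neighbour -pf pg /neighbour; congr (glue _).1.
  by apply: side_of_color_uniq; rewrite ?pf //= pc !side_of_colorE.
- by move=> u _; exists (f' u); rewrite f'K.
Qed.

End EssentialEmbeddings.

Lemma restrict_essential_embedding a b (S : surface a b) (A : pred (tri S))
    (SA : is_surface A) :
    (forall t, ~~ unlabelled_double t -> A t) ->
  essential_embedding (val : tri (restrict SA) -> tri S).
Proof.
move=> Aud; split=> //; first exact: val_inj.
by move=> u /Aud Au; exists (exist _ u Au).
Qed.

Lemma neighbour_closed_is_surface a b (S : surface a b) (A : pred (tri S)) :
    (forall t c, A t -> A (neighbour t c)) ->
    (forall k, A (lab_plus S k)) -> (forall k, A (lab_minus S k)) ->
  is_surface A.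
Proof.
move=> An Ap Am; have SP := surfaceP S; split; try by case: SP => *; auto.
- by move=> s As; rewrite glue_neighbour An.
- by move=> k; rewrite Ap; have /andP[] := surf_lab_plus SP k.
- by move=> k; rewrite Am; have /andP[] := surf_lab_minus SP k.
Qed.

(** * Gluing and essential embeddings *)

Section Paste.
Context (alpha beta gamma : nat).
Context (P : surface alpha beta) (Q : surface beta gamma).

Lemma paste_inl (s : tri P * 'I_3) :
  (paste (inl_side Q s)).1 =
  if [pick k | lab_plus P k == (glue s).1] is Some k
  then inr (neighbour (lab_minus Q k) (side_color s)) else inl (glue s).1.
Proof.
case: s => x i /=; case: pickP => //= k _.
by rewrite (surf_color (surfaceP P)).
Qed.

Lemma paste_inr (s : tri Q * 'I_3) :
  (paste (inr_side P s)).1 =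
  if [pick k | lab_minus Q k == (glue s).1] is Some k
  then inl (neighbour (lab_plus P k) (side_color s)) else inr (glue s).1.
Proof.
case: s => x i /=; case: pickP => //= k _.
by rewrite (surf_color (surfaceP Q)).
Qed.

Lemma neighbour_paste (t : tri (paste_surface P Q)) c :
  val (neighbour t c) =
  match val t with
  | inl x => if [pick k | lab_plus P k == neighbour x c] is Some k
             then inr (neighbour (lab_minus Q k) c) else inl (neighbour x c)
  | inr y => if [pick k | lab_minus Q k == neighbour y c] is Some k
             then inl (neighbour (lab_plus P k) c) else inr (neighbour y c)
  end.
Proof.
case: t => -[x|y] tr.
  rewrite -[LHS]/(paste (inl_side Q (side_of_color x c))).1.
  by rewrite paste_inl side_of_colorE.
rewrite -[LHS]/(paste (inr_side P (side_of_color y c))).1.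
by rewrite paste_inr side_of_colorE.
Qed.

Lemma pick_lab_none a b (C : complex a b) (n : nat) (l : 'I_n -> tri C) u :
  ~~ [exists k, l k == u] -> [pick k | l k == u] = None.
Proof. by case: pickP => // k lk /existsP[]; exists k. Qed.

(** The other triangle of an unlabelled double triangle of P is not one of the
    removed triangles, so the component meets no hole and survives. *)
Lemma unlabelled_double_inl (t : tri (paste_surface P Q)) x :
  val t = inl x -> unlabelled_double x -> unlabelled_double t.
Proof.
move=> tx /unlabelled_doubleP[u [nx /norP[_ mx] /norP[pu mu]]].
have nt c : val (neighbour t c) = inl u.
  by rewrite neighbour_paste tx nx pick_lab_none.
have lab (v : tri (paste_surface P Q)) y :
    val v = inl y -> ~~ [exists k, lab_minus P k == y] -> ~~ labelled v.
  move=> vy; apply: contra => /orP[] /existsP[k /eqP kv].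
    by have := congr1 val kv; rewrite vy.
  by apply/existsP; exists k; have := congr1 val kv; rewrite vy => -[->].
apply/unlabelled_doubleP; exists (neighbour t Red); split.
- by move=> c; apply: val_inj; rewrite !nt.
- exact: lab tx mx.
- exact: lab (nt Red) mu.
Qed.

Lemma unlabelled_double_inr (t : tri (paste_surface P Q)) y :
  val t = inr y -> unlabelled_double y -> unlabelled_double t.
Proof.
move=> ty /unlabelled_doubleP[u [ny /norP[py _] /norP[pu mu]]].
have nt c : val (neighbour t c) = inr u.
  by rewrite neighbour_paste ty ny pick_lab_none.
have lab (v : tri (paste_surface P Q)) z :
    val v = inr z -> ~~ [exists k, lab_plus Q k == z] -> ~~ labelled v.
  move=> vz; apply: contra => /orP[] /existsP[k /eqP kv].
    by apply/existsP; exists k; have := congr1 val kv; rewrite vz => -[->].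
  by have := congr1 val kv; rewrite vz.
apply/unlabelled_doubleP; exists (neighbour t Red); split.
- by move=> c; apply: val_inj; rewrite !nt.
- exact: lab ty py.
- exact: lab (nt Red) pu.
Qed.

End Paste.

(** The holes correspond because their labels do, so the two maps agree with
    crossing a hole; the triangles that are missed lie in unlabelled double
    triangles of P' or Q', which remain such after pasting. *)
Lemma paste_essential_embedding alpha beta gamma (P P' : surface alpha beta)
    (Q Q' : surface beta gamma) (f : tri P -> tri P') (g : tri Q -> tri Q') :
    essential_embedding f -> essential_embedding g ->
  exists h : tri (paste_surface P Q) -> tri (paste_surface P' Q'),
    essential_embedding h.
Proof.
move=> [fi fp fn flp flm fs] [gi gp gn glp glm gs].
pose h0 (t : tri P + tri Q) : tri P' + tri Q' :=
  match t with inl x => inl (f x) | inr y => inr (g y) end.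
have fE x k : (lab_plus P' k == f x) = (lab_plus P k == x).
  by rewrite -flp (inj_eq fi).
have gE y k : (lab_minus Q' k == g y) = (lab_minus Q k == y).
  by rewrite -glm (inj_eq gi).
have h0r t : remaining (h0 t) = remaining t.
  by case: t => [x|y] /=; congr negb; apply: eq_existsb.
pose h (t : tri (paste_surface P Q)) : tri (paste_surface P' Q') :=
  exist _ (h0 (val t)) (etrans (h0r (val t)) (valP t)).
exists h; split.
- move=> t t' tt'; apply: val_inj; have := congr1 val tt' => /=.
  by case: (val t) (val t') => [x|x] [y|y] //= [] => [/fi|/gi] ->.
- by move=> [[x|y] tr] /=; rewrite ?fp ?gp.
- move=> t c; apply: val_inj; rewrite neighbour_paste.
  rewrite -[LHS]/(h0 (val (neighbour t c))) neighbour_paste /=.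
  case: (val t) => [x|y] /=.
    rewrite -fn (eq_pick (fE _)); case: pickP => //= k _.
    by rewrite gn glm.
  rewrite -gn (eq_pick (gE _)); case: pickP => //= k _.
  by rewrite fn flp.
- by move=> k; apply: val_inj; rewrite /= glp.
- by move=> k; apply: val_inj; rewrite /= flm.
move=> [[x'|y'] tr] nd.
  have [|x xE] := fs x'.
    by apply: contra nd; apply: unlabelled_double_inl.
  have xr : remaining (inl x : tri P + tri Q) by rewrite -h0r /= xE.
  by exists (exist _ (inl x) xr); apply: val_inj; rewrite /= xE.
have [|y yE] := gs y'.
  by apply: contra nd; apply: unlabelled_double_inr.
have yr : remaining (inr y : tri P + tri Q) by rewrite -h0r /= yE.
by exists (exist _ (inr y) yr); apply: val_inj; rewrite /= yE.
Qed.

Lemma paste_discard_equivalent alpha beta gamma (P P' : surface alpha beta)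
    (Q Q' : surface beta gamma) (f : tri P -> tri P') (g : tri Q -> tri Q') :
    essential_embedding f -> essential_embedding g ->
  equivalent (discard (paste_surface P Q)) (discard (paste_surface P' Q')).
Proof.
move=> fE gE; have [h hE] := paste_essential_embedding fE gE.
exact: essential_embedding_discard hE.
Qed.

(** * Surfaces of group elements *)

Section Permutations.
Context (a b : nat).

Lemma neighbour_G g t c :
  neighbour (t : tri (G_surface a b g)) c =
  (~~ t.1, if t.1 then component g c t.2 else (component g c)^-1%g t.2).
Proof.
case: t => e n; have := side_of_colorE (S := G_surface a b g) (e, n) c.
rewrite /neighbour /side_of_color; set i := odflt _ _ => /= <-.
by [].
Qed.

Lemma unlabelled_double_G g e n : a <= n -> b <= n ->
    (forall c, component g c n = n) ->
  unlabelled_double ((e, n) : tri (G_surface a b g)).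
Proof.
move=> an bn gn; apply/unlabelled_doubleP; exists (~~ e, n).
have gVn c : (component g c)^-1%g n = n by rewrite -[in LHS](gn c) sinfK.
have nl e' : ~~ labelled ((e', n) : tri (G_surface a b g)).
  by apply/norP; split; apply/existsP => -[[k kP] /= /eqP[_ kn]]; lia.
split=> // c; rewrite neighbour_G.
by case: (e); congr (_, _); [exact: gn|exact: gVn].
Qed.

End Permutations.

(** * The surface of g theta_j h *)

Section ThetaProduct.
Context (alpha beta gamma : nat) (g h : G) (N j : nat).
Hypothesis gN : forall c n, N <= n -> component g c n = n.
Hypothesis hN : forall c n, N <= n -> component h c n = n.
Hypotheses (jN : N <= j) (ja : alpha <= j) (jg : gamma <= j).

Local Notation r := (theta_product beta g h j).
Local Notation M := (beta + j)%N.

(** A value outside the support is a fixed point, so by injectivity it is taken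
    only there. *)
Lemma component_lt (u : G) c n m :
    (forall c n, N <= n -> component u c n = n) ->
  N <= m -> n < m -> component u c n < m.
Proof.
move=> uN Nm nm; rewrite ltnNge; apply/negP => mu.
by have /sinf_inj := uN c (component u c n) (leq_trans Nm mu); lia.
Qed.

(** When n < beta + j and h_c n >= beta, theta_j adds j to h_c n, which brings
    it beyond the support of g; this is why that value does not involve g. *)
Lemma theta_productE c n :
  component r c n =
  if n < M then
    let m := component h c n in if m < beta then component g c m else (m + j)%N
  else if n < M + j then component g c (n - j) else n.
Proof.
rewrite /theta_product !componentM !sinfM.
have -> : component (diagonal (theta beta j)) c = theta beta j by case: c.
rewrite /= /theta_fun; case: (ltnP n M) => nM.
  have hM : component h c n < M by apply: component_lt => //; lia.
  by case: ifP => hb //; rewrite hM gN //; lia.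
rewrite hN; last by lia.
have [-> ->] : (n < beta) = false /\ (n < M) = false by split; lia.
case: ifP => // nMj; apply: gN; lia.
Qed.

Definition small (t : tri (G_surface alpha gamma r)) := t.2 < M + j.

Lemma theta_product_far_fixed c n : M + j <= n -> component r c n = n.
Proof. by move=> Mn; rewrite theta_productE !ifF //; lia. Qed.

Lemma small_surface : is_surface small.
Proof.
have rM := theta_product_far_fixed.
apply: neighbour_closed_is_surface => [[e n] c sn|k|k].
- rewrite /small in sn *; rewrite neighbour_G /= in sn *; rewrite ltnNge.
  apply: contraTN sn => Mn; rewrite -leqNgt.
  case: e Mn => Mn.
    by have /sinf_inj <- := rM c _ Mn.
  move: Mn; set m := (X in _ <= X) => Mn.
  by rewrite -[n](sinfVK (component r c)) -/m rM.
- have := ltn_ord k; rewrite /small /=; lia.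
- have := ltn_ord k; rewrite /small /=; lia.
Qed.

(** The numbers below beta + j name plus-triangles of the surface of h and
    minus-triangles of the surface of g.  The numbers from beta + j on, shifted
    by j, name the triangles of the other two families, plus-triangles of g and
    minus-triangles of h; the shift skips those numbered below beta, which are
    the ones removed by the gluing. *)
Definition theta_split (t : bool * nat) : (bool * nat) + (bool * nat) :=
  if t.2 < M then (if t.1 then inr t else inl t)
  else (if t.1 then inl (t.1, t.2 - j)%N else inr (t.1, t.2 - j)%N).

Local Notation PQ :=
  (paste_surface (G_surface alpha beta g) (G_surface beta gamma h)).

Lemma remaining_theta_split t :
  @remaining _ _ _ (G_surface alpha beta g) (G_surface beta gamma h)
    (theta_split t).
Proof.
case: t => -[] n; rewrite /theta_split /=; case: (ltnP n M) => nM //=;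
  apply/existsP => -[[k kb] /= /eqP[]] //; lia.
Qed.

Definition theta_embedding (t : tri (restrict small_surface)) : tri PQ :=
  exist _ (theta_split (val t)) (remaining_theta_split (val t)).

Lemma theta_embedding_essential : essential_embedding theta_embedding.
Proof.
have thp t : plus (theta_embedding t) = plus t.
  case: t => -[[] n] sn; by rewrite /= /theta_split /=; case: ifP.
split=> //.
- move=> [[e n] sn] [[e' n'] sn'] E; apply: val_inj; have {E} := congr1 val E.
  rewrite /= /theta_split /small /= in sn sn' *.
  by case: e e' {sn sn'} => [] []; case: (ltnP n M) => nM;
    case: (ltnP n' M) => n'M //= [] // E; congr (_, _); lia.
- apply: neighbour_plus_suffices => // -[[e n] sn] c ep.
  case: e sn ep => // sn _; apply: val_inj; rewrite neighbour_paste.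
  rewrite -[LHS]/(theta_split
    (neighbour ((true, n) : tri (G_surface alpha gamma r)) c)) neighbour_G.
  rewrite -[LHS]/(theta_split (false, component r c n)) theta_productE.
  rewrite -[val (theta_embedding _)]/(theta_split (true, n)).
  rewrite /theta_split /=; case: (ltnP n M) => nM.
    rewrite neighbour_G /=.
    have hM : component h c n < M by apply: component_lt => //; lia.
    (* Either h_c n is the number k of a hole, or h_c n >= beta. *)
    case: pickP => [k /eqP[km]|nk].
      have kb := ltn_ord k.
      rewrite -km kb neighbour_G /= ifT //.
      by apply: component_lt => //; lia.
    have hb : (component h c n < beta) = false.
      by apply/negP => hb; have := nk (Ordinal hb); rewrite /= eqxx.
    by rewrite hb ifF ?addnK //; lia.
  have nMj : n < M + j := sn.
  rewrite nMj neighbour_G /=.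
  have gM : component g c (n - j) < M by apply: component_lt => //; lia.
  by rewrite gM; case: pickP.
- move=> k; apply: val_inj; rewrite /= /theta_split /=.
  by rewrite ifT //; have := ltn_ord k; lia.
- move=> k; apply: val_inj; rewrite /= /theta_split /=.
  by rewrite ifT //; have := ltn_ord k; lia.
- move=> [[[e m]|[e m]] ur] und.
  - have mM : m < M.
      rewrite ltnNge; apply: contra und => Mm.
      apply: (@unlabelled_double_inl _ _ _ (G_surface alpha beta g)
        (G_surface beta gamma h) _ (e, m)) => //.
      by apply: unlabelled_double_G => [||c]; [lia|lia|apply: gN; lia].
    case: e ur {und} => ur.
      have bm : beta <= m.
        rewrite leqNgt; apply: contra ur => mb.
        by apply/existsP; exists (Ordinal mb).
      have sm : small (true, m + j)%N by rewrite /small /=; lia.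
      exists (exist small _ sm); apply: val_inj.
      by rewrite /= /theta_split /= ifF ?addnK //; lia.
    have sm : small (false, m) by rewrite /small /=; lia.
    by exists (exist small _ sm); apply: val_inj; rewrite /= /theta_split /= mM.
  - have mM : m < M.
      rewrite ltnNge; apply: contra und => Mm.
      apply: (@unlabelled_double_inr _ _ _ (G_surface alpha beta g)
        (G_surface beta gamma h) _ (e, m)) => //.
      by apply: unlabelled_double_G => [||c]; [lia|lia|apply: hN; lia].
    case: e ur {und} => ur.
      have sm : small (true, m) by rewrite /small /=; lia.
      exists (exist small _ sm); apply: val_inj.
      by rewrite /= /theta_split /= mM.
    have bm : beta <= m.
      rewrite leqNgt; apply: contra ur => mb.
      by apply/existsP; exists (Ordinal mb).
    have sm : small (false, m + j)%N by rewrite /small /=; lia.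
    exists (exist small _ sm); apply: val_inj.
    by rewrite /= /theta_split /= ifF ?addnK //; lia.
Qed.

(** The truncation to small numbers embeds in both surfaces: in the first
    because g theta_j h fixes the numbers from beta + 2j on, in the second by
    the renumbering above. *)
Lemma discard_theta_product :
  equivalent (discard (G_surface alpha gamma r)) (discard PQ).
Proof.
apply: equivalent_trans (essential_embedding_discard theta_embedding_essential).
apply: equivalent_sym; apply: essential_embedding_discard.
apply: restrict_essential_embedding => -[e n].
apply: contraR; rewrite /small /= -leqNgt => Mn.
apply: unlabelled_double_G => [||c]; [lia|lia|exact: theta_product_far_fixed].
Qed.

End ThetaProduct.

Theorem proposition3p5 (alpha beta gamma : nat)
    (p : dcoset alpha beta) (q : dcoset beta gamma)
    (P : L alpha beta) (Q : L beta gamma)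
    (hP : corresponds p P) (hQ : corresponds q Q) :
  corresponds (dcprod p q) (gluing P Q).
Proof.
have [[g pg gP] [h qh hQ']] := (hP, hQ).
have [N0 prodE] := dcprodP pg qh.
have [[Ng gN] [Nh hN]] := (G_bound g, G_bound h).
pose N := (Ng + Nh)%N; pose j := (N0 + N + alpha + gamma)%N.
exists (theta_product beta g h j).
  by rewrite -(prodE j) ?/j; [exact: double_coset_refl|lia].
apply: equivalent_trans (_ : equivalent _ (discard
    (paste_surface (G_surface alpha beta g) (G_surface beta gamma h)))) _.
  by apply: (@discard_theta_product _ _ _ _ _ N) => [c n Nn|c n Nn|||];
    [apply: gN|apply: hN|..]; lia.
(* The reduced surfaces of g and h embed essentially in the undiscarded ones
   and are equivalent to P and Q. *)
have [f fE] := equivalent_essential_embedding gP.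
have [f' fE'] := equivalent_essential_embedding hQ'.
apply: equivalent_trans (paste_discard_equivalent fE fE').
apply: equivalent_sym; apply: paste_discard_equivalent;
  exact: restrict_essential_embedding.
Qed.
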